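(* Let $\mathbf{V}$ be a variety of algebras of type $\mathcal{L}$, let $n$ be a positive integer, let $S$ be a system of equations in the variables $x_1,\dots,x_n$ in the variety $\mathbf{V}$, and let $A\in\mathbf{V}$. If $\mathrm{Rad}_A(S)$ is a fully characteristic congruence of $F_{\mathbf{V}}(n)$, then there is a family $\mathfrak{X}$ of $n$-generator subalgebras of $A$ such that $$\mathrm{Rad}_A(S)=\mathrm{id}_{\mathfrak{X}}(n).$$
   Context: $\mathcal{L}$ is an algebraic (purely functional) language. $X=\{x_1,\dots,x_n\}$ is a finite set of variables and $F_{\mathbf{V}}(n)$ is the relatively free algebra of $\mathbf{V}$ generated by $X$. For $p\in F_{\mathbf{V}}(n)$, $A\in\mathbf{V}$ and $\overline{a}=(a_1,\dots,a_n)\in A^n$, $p(\overline{a})\in A$ is the image of $p$ under the unique homomorphism $F_{\mathbf{V}}(n)\to A$ with $x_i\mapsto a_i$. An equation is a pair $(p,q)$, also written $p\approx q$, of elements of $F_{\mathbf{V}}(n)$ (terms in $x_1,\dots,x_n$); a system of equations is a set of equations. $V_A(S)=\{\overline{a}\in A^n : p(\overline{a})=q(\overline{a}) \text{ for all } (p,q)\in S\}$, and $\mathrm{Rad}_A(S)=\{(p,q)\in F_{\mathbf{V}}(n)^2 : p(\overline{a})=q(\overline{a})\text{ for all }\overline{a}\in V_A(S)\}$, a congruence of $F_{\mathbf{V}}(n)$. A congruence $R$ of $F_{\mathbf{V}}(n)$ is fully characteristic (fully invariant) if $(\alpha(p),\alpha(q))\in R$ for every endomorphism $\alpha$ of $F_{\mathbf{V}}(n)$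 and every $(p,q)\in R$. An $n$-generator subalgebra is one generated by some $n$ (not necessarily distinct) elements. For a family $\mathfrak{X}$ of algebras in $\mathbf{V}$, $\mathrm{id}_{\mathfrak{X}}(n)$ is the set of all identities in the variables $x_1,\dots,x_n$ valid in every member of $\mathfrak{X}$, i.e. the set of $(p,q)\in F_{\mathbf{V}}(n)^2$ with $p(\overline{a})=q(\overline{a})$ for all $K\in\mathfrak{X}$ and all $\overline{a}\in K^n$. Families may be empty. *)

(* Defs.v *)
From HB Require Import structures.
From mathcomp Require Import all_boot.
From mathcomp Require Import generic_quotient.
From mathcomp Require Import boolp classical_sets.

Set Implicit Arguments.
Unset Strict Implicit.
Unset Printing Implicit Defensive.

Local Open Scope classical_set_scope.
Local Open Scope quotient_scope.

Record language := Language {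
  symbol : Type;
  arity : symbol -> nat }.

(* The carrier is allowed to be empty.  This is immaterial in what follows:
   the empty algebra satisfies every identity, so admitting it in a variety
   does not change the identities in n >= 1 variables. *)
Record algebra (L : language) := Algebra {
  carrier :> Type;
  interp : forall f : symbol L, ('I_(arity f) -> carrier) -> carrier }.

Definition is_hom (L : language) (A B : algebra L) (h : A -> B) : Prop :=
  forall (f : symbol L) (args : 'I_(arity f) -> A),
    h (interp args) = interp (fun i => h (args i)).

Inductive term (L : language) (X : Type) : Type :=
| Var of X
| App (f : symbol L) of ('I_(arity f) -> term L X).

Arguments Var {L X}.
Arguments App {L X} f.

HB.instance Definition _ (L : language) (X : Type) := gen_eqMixin (term L X).
HB.instance Definition _ (L : language) (X : Type) :=
  gen_choiceMixin (term L X).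

Fixpoint teval (L : language) (X : Type) (A : algebra L) (a : X -> A)
    (t : term L X) : A :=
  match t with
  | Var x => a x
  | App f ts => interp (fun i => teval a (ts i))
  end.

Definition satisfies (L : language) (A : algebra L)
    (E : set (term L nat * term L nat)) : Prop :=
  forall e, E e -> forall a : nat -> A, teval a e.1 = teval a e.2.

(* Classes of algebras are written [algebra L -> Prop] rather than
   [set (algebra L)] for universe reasons: quotient types live in the universe
   of the canonical choice structure on [set]. *)
Definition variety (L : language) (V : algebra L -> Prop) : Prop :=
  exists E : set (term L nat * term L nat), forall A : algebra L, V A <-> satisfies A E.

Section FreeAlgebra.
Variables (L : language) (V : algebra L -> Prop) (n : nat).

Definition valid_rel (s t : term L 'I_n) : bool :=
  `[< forall A : algebra L, V A ->
      forall a : 'I_n -> A, teval a s = teval a t >].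

Lemma valid_rel_refl : reflexive valid_rel.
Proof. by move=> s; apply/asboolP. Qed.

Lemma valid_rel_sym : symmetric valid_rel.
Proof.
by move=> s t; apply/asboolP/asboolP => st A VA a; rewrite st.
Qed.

Lemma valid_rel_trans : transitive valid_rel.
Proof.
move=> t s u /asboolP st /asboolP tu; apply/asboolP => A VA a.
by rewrite st // tu.
Qed.

Canonical valid_equiv :=
  EquivRel valid_rel valid_rel_refl valid_rel_sym valid_rel_trans.

(* The relatively free algebra F_V(n): n-ary terms modulo the identities
   of V. *)
Definition free : algebra L :=
  @Algebra L {eq_quot valid_equiv}
    (fun f args =>
       \pi_{eq_quot valid_equiv} (App f (fun i => repr (args i)))).

Definition term_class (t : term L 'I_n) : free := \pi_{eq_quot valid_equiv} t.

Definition term_repr (p : free) : term L 'I_n :=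
  repr (p : {eq_quot valid_equiv}).

Lemma term_reprK : cancel term_repr term_class.
Proof. by move=> p; rewrite /term_class /term_repr reprK. Qed.

Lemma term_class_eq (s t : term L 'I_n) :
  (forall A : algebra L, V A -> forall a : 'I_n -> A, teval a s = teval a t) <->
  term_class s = term_class t.
Proof.
split=> [st|/eqmodP/asboolP//].
by apply/eqmodP/asboolP.
Qed.

Definition gen (i : 'I_n) : free := term_class (Var i).

(* p(a).  When A belongs to V this is the image of p under the unique
   homomorphism F_V(n) -> A mapping each generator x_i to a_i: see
   [feval_hom], [feval_gen] and [feval_unique]. *)
Definition feval (A : algebra L) (a : 'I_n -> A) (p : free) : A :=
  teval a (term_repr p).

Lemma feval_class (A : algebra L) (a : 'I_n -> A) (t : term L 'I_n) :
  V A -> feval a (term_class t) = teval a t.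
Proof.
have /term_class_eq/[apply] := term_reprK (term_class t).
exact.
Qed.

Lemma feval_gen (A : algebra L) (a : 'I_n -> A) (i : 'I_n) :
  V A -> feval a (gen i) = a i.
Proof. by move=> VA; rewrite /gen feval_class. Qed.

Lemma feval_hom (A : algebra L) (a : 'I_n -> A) : V A -> is_hom (feval a).
Proof. by move=> VA f args; rewrite [LHS]feval_class. Qed.

Lemma interp_class (f : symbol L) (ts : 'I_(arity f) -> term L 'I_n) :
  @interp L free f (fun i => term_class (ts i)) = term_class (App f ts).
Proof.
apply/term_class_eq => A VA a /=; congr (interp _); apply: funext => i.
exact: feval_class.
Qed.

Lemma feval_unique (A : algebra L) (a : 'I_n -> A) (h : free -> A) :
  is_hom h -> (forall i, h (gen i) = a i) -> h = feval a.
Proof.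
move=> hh hx; apply: funext => p; rewrite /feval -[in LHS](term_reprK p).
elim: (term_repr p) => [i|f ts IH] /=; first exact: hx.
by rewrite -interp_class hh; congr (interp _); apply: funext => i; apply: IH.
Qed.

End FreeAlgebra.

Section Tsubst.
Variables (L : language) (X Y : Type).

Fixpoint tsubst (s : X -> term L Y) (t : term L X) : term L Y :=
  match t with
  | Var x => s x
  | App f ts => App f (fun i => tsubst s (ts i))
  end.

Lemma teval_tsubst (A : algebra L) (a : Y -> A) (s : X -> term L Y)
    (t : term L X) :
  teval a (tsubst s t) = teval (fun x => teval a (s x)) t.
Proof.
elim: t => [//|f ts IH] /=; congr (interp _); apply: funext => i; exact: IH.
Qed.

End Tsubst.

Lemma free_in_variety (L : language) (V : algebra L -> Prop) (n : nat) :
  variety V -> V (free V n).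
Proof.
move=> [E VE]; apply/VE => e Ee a.
have ev (t : term L nat) :
    teval a t = term_class V (tsubst (fun x => term_repr (a x)) t).
  elim: t => [x|f ts IH]; first by rewrite /= term_reprK.
  rewrite -[RHS]interp_class; apply: (congr1 (@interp L (free V n) f)).
  by apply: funext => i; apply: IH.
rewrite !ev; apply/term_class_eq => A VA b.
by rewrite !teval_tsubst; move/VE: VA; apply.
Qed.

Definition congruence (L : language) (A : algebra L) (R : set (A * A)) : Prop :=
  [/\ forall p, R (p, p),
      forall p q, R (p, q) -> R (q, p),
      forall p q r, R (p, q) -> R (q, r) -> R (p, r) &
      forall (f : symbol L) (u v : 'I_(arity f) -> A),
        (forall i, R (u i, v i)) -> R (interp u, interp v)].

Definition fully_characteristic (L : language) (A : algebra L)
    (R : set (A * A)) : Prop :=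
  congruence R /\
  forall h : A -> A, is_hom h -> forall p q, R (p, q) -> R (h p, h q).

Definition solutions (L : language) (V : algebra L -> Prop) (n : nat)
    (A : algebra L) (S : set (free V n * free V n)) : set ('I_n -> A) :=
  [set a | forall p q, S (p, q) -> feval a p = feval a q].

Definition Rad (L : language) (V : algebra L -> Prop) (n : nat)
    (A : algebra L) (S : set (free V n * free V n)) :
    set (free V n * free V n) :=
  [set e | forall a : 'I_n -> A, solutions S a -> feval a e.1 = feval a e.2].

Arguments Rad {L V n} A S.

Definition identities (L : language) (V : algebra L -> Prop) (n : nat)
    (X : algebra L -> Prop) : set (free V n * free V n) :=
  [set e | forall K : algebra L, X K ->
           forall a : 'I_n -> K, feval a e.1 = feval a e.2].

Arguments identities {L} V n X.

Section Subalgebra.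
Variables (L : language) (A : algebra L).

Definition subuniverse (B : set A) : Prop :=
  forall (f : symbol L) (args : 'I_(arity f) -> A),
    (forall i, B (args i)) -> B (interp args).

Definition subalgebra (B : set A) (clB : subuniverse B) : algebra L :=
  @Algebra L {x : A | B x}
    (fun f args => exist B (interp (fun i => sval (args i)))
                           (clB f _ (fun i => svalP (args i)))).

Definition generated (G : set A) : set A := smallest subuniverse G.

Lemma generated_subuniverse (G : set A) : subuniverse (generated G).
Proof.
move=> f args Gargs B BG; have [clB _] := BG.
by apply: clB => i; apply: Gargs.
Qed.

Definition n_generator_subalgebra (n : nat) (K : algebra L) : Prop :=
  exists a : 'I_n -> A,
    K = subalgebra (generated_subuniverse (G := range a)).

End Subalgebra.

Lemma subalgebra_in_variety (L : language) (V : algebra L -> Prop)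
    (A : algebra L) (B : set A) (clB : subuniverse B) :
  variety V -> V A -> V (subalgebra clB).
Proof.
move=> [E VE] /VE AE; apply/VE => e Ee a.
have ev (t : term L nat) : sval (teval a t) = teval (fun x => sval (a x)) t.
  elim: t => [//|f ts IH] /=; congr (interp _); apply: funext => i.
  exact: IH.
by apply: eq_sig_hprop => [x|]; [exact: Prop_irrelevance|rewrite !ev; apply: AE].
Qed.

(* Main.v *)
(* Take for X the subalgebras <a> generated by the solutions a of S.  A tuple
   of <a> has the form (r_1(a), ..., r_n(a)) with r_i in F_V(n), so evaluating
   an equation at it amounts to applying the endomorphism x_i |-> r_i of
   F_V(n) and then evaluating at a; full invariance of the radical gives one
   inclusion.  The other follows by evaluating at a itself, seen in <a>. *)
Require Import Defs.
From mathcomp Require Import all_boot.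
From mathcomp Require Import boolp classical_sets.

Local Open Scope classical_set_scope.

Lemma hom_teval {L : language} {X : Type} {A B : algebra L} {h : A -> B}
    (a : X -> A) (t : term L X) :
  is_hom h -> h (teval a t) = teval (h \o a) t.
Proof.
move=> hh; elim: t => [//|f ts IH] /=.
by rewrite hh; congr (interp _); apply: funext => i; exact: IH.
Qed.

(** Both sides evaluate the same representative term of [p], so this reduces to terms. *)
Lemma hom_feval {L : language} {V : algebra L -> Prop} {n : nat}
    {A B : algebra L} {h : A -> B} (a : 'I_n -> A) (p : free V n) :
  is_hom h -> h (feval a p) = feval (h \o a) p.
Proof. exact: hom_teval. Qed.

Lemma sval_hom {L : language} {A : algebra L} {B : set A}
    (clB : subuniverse B) :
  @is_hom L (subalgebra clB) A sval.
Proof. by []. Qed.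

(** The range of [feval a] is a homomorphic image, hence a subuniverse, and it contains each [a i]
    as the value of a generator. *)
Lemma generated_range_feval {L : language} {V : algebra L -> Prop} {n : nat}
    {A : algebra L} (a : 'I_n -> A) :
  V A -> generated (range a) `<=` range (feval a : free V n -> A).
Proof.
move=> VA; apply: smallest_sub => [f args fargs|_ [i _ <-]].
  have /choice[r ar] i : exists p : free V n, feval a p = args i.
    by have [p _ ap] := fargs i; exists p.
  exists (interp r) => //; rewrite feval_hom//.
  by congr (interp _); apply: funext.
by exists (gen V i) => //; exact: feval_gen.
Qed.

Theorem corollary1 (L : language) (V : algebra L -> Prop) (hV : variety V)
    (n : nat) (hn : (0 < n)%N) (S : set (free V n * free V n))
    (A : algebra L) (hA : V A)
    (hR : fully_characteristic (Rad A S)) :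
  exists X : algebra L -> Prop,
    (forall K, X K -> n_generator_subalgebra A n K) /\
    Rad A S = identities V n X.
Proof.
exists (fun K => exists2 a : 'I_n -> A, solutions S a &
  K = subalgebra (generated_subuniverse (G := range a))).
split=> [K [a _ ->]|]; first by exists a.
apply/seteqP; split=> -[p q] /= pq.
  move=> _ [a Sa ->] b.
  have /choice[r ar] i : exists s : free V n, feval a s = sval (b i).
    case: (b i) => x /= /(generated_range_feval a hA)[s _ sE].
    by exists s.
  have rhom : is_hom (feval r : free V n -> free V n).
    exact: feval_hom (free_in_variety n hV).
  have /(_ a Sa) /= := hR.2 _ rhom _ _ pq.
  have aE : feval a \o r = sval \o b by apply: funext.
  (* Evaluating at [r] and then at [a] is evaluating at [sval \o b]; pulling [sval] out leaves an
     equality between values at [b]. *)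
  rewrite !(hom_feval r _ (feval_hom a hA)) aE.
  rewrite -!(hom_feval b _ (sval_hom _)).
  by move=> pqb; apply: eq_sig_hprop => [x|//]; exact: Prop_irrelevance.
move=> a Sa /=.
have aG i : generated (range a) (a i) by move=> B [_]; apply; exists i.
pose b i : subalgebra (generated_subuniverse (G := range a)) :=
  exist _ (a i) (aG i).
have /(congr1 sval) := pq _ (ex_intro2 _ _ a Sa erefl) b.
(* [sval \o b] is convertible to [a]. *)
by rewrite !(hom_feval b _ (sval_hom _)).
Qed.
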